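(* Let $L$ be a background language, $\mathfrak{B}$ an atomic base over $L$, and $\mathtt{GG}$ the system of Gentzen-grounding over the enriched Gentzen-language $\mathtt{Gen}^\varepsilon$ over $\mathfrak{B}$. For all formulas $\alpha,\beta,\alpha_1,\alpha_2$ (respectively $\alpha(x)$) of $L$ and all terms $t$ of $L$ free for $x$ in $\alpha(x)$, with $x$ not free in $\beta$ in item (5), the following formulas are derivable in $\mathtt{GG}$ from no assumptions: (1) $\Pi\xi^{\alpha_1\wedge\alpha_2}\big(\xi^{\alpha_1\wedge\alpha_2}:\alpha_1\wedge\alpha_2\ \supset\ \wedge_{E,i}(\xi^{\alpha_1\wedge\alpha_2}):\alpha_i\big)$ for $i=1,2$; (2) $\Pi\xi^{\alpha_1\vee\alpha_2}\,\Pi\mathtt{f}^\beta_1\,\Pi\mathtt{f}^\beta_2\big(((\xi^{\alpha_1\vee\alpha_2}:\alpha_1\vee\alpha_2\times\Pi\xi^{\alpha_1}(\xi^{\alpha_1}:\alpha_1\supset\mathtt{f}^\beta_1(\xi^{\alpha_1}):\beta))\times\Pi\xi^{\alpha_2}(\xi^{\alpha_2}:\alpha_2\supset\mathtt{f}^\beta_2(\xi^{\alpha_2}):\beta))\ \supset\ \vee E\,\xi^{\alpha_1}\,\xi^{\alpha_2}(\xi^{\alpha_1\vee\alpha_2},\mathtt{f}^\beta_1(\xi^{\alpha_1}),\mathtt{f}^\beta_2(\xi^{\alpha_2})):\beta\big)$; (3) $\Pi\xi^{\alpha\to\beta}\,\Pi\xi^\alpha\big((\xi^{\alpha\to\beta}:\alpha\to\beta\times\xi^\alpha:\alpha)\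 \supset\ \to\! E(\xi^{\alpha\to\beta},\xi^\alpha):\beta\big)$; (4) $\Pi\xi^{\forall x\alpha(x)}\big(\xi^{\forall x\alpha(x)}:\forall x\,\alpha(x)\ \supset\ \forall E(\xi^{\forall x\alpha(x)}):\alpha(t)\big)$; (5) $\Pi\xi^{\exists x\alpha(x)}\,\Pi\mathtt{f}^\beta\big((\xi^{\exists x\alpha(x)}:\exists x\,\alpha(x)\times\Pi x\,\Pi\xi^{\alpha(x)}(\xi^{\alpha(x)}:\alpha(x)\supset\mathtt{f}^\beta(\xi^{\alpha(x)}):\beta))\ \supset\ \exists E\,x\,\xi^{\alpha(x)}(\xi^{\exists x\alpha(x)},\mathtt{f}^\beta(\xi^{\alpha(x)})):\beta\big)$.
   Context: **Background language and base.** $L$ is a first-order language with logical constants $\wedge,\vee,\to,\forall,\exists$ and an atomic constant $\bot$; $\mathrm{TERM}_L,\mathrm{ATOM}_L,\mathrm{FORM}_L$ are its sets of terms, atomic formulas and formulas. An atomic system over $L$ is a pair $\mathtt{S}=\langle L^*,\mathfrak{R}\rangle$ with $L^*\subseteq L$ and $\mathfrak{R}$ a recursively axiomatisable set of production rules from $\alpha_1,\dots,\alpha_n$ to $\beta$, where each $\alpha_i$ is an atomic formula of $L^*$ other than $\bot$, $\beta$ is an atomic formula of $L^*$ or $\bot$, and every variable free in $\beta$ is free in some $\alpha_i$. $\mathrm{DER}_{\mathtt{S}}$ is the set of its derivations. An atomic base $\mathfrak{B}$ over $L$ is a triple: the individual constants of $L$, the relational constants of $L$, and an atomic system $\mathtt{S}$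 over $L$. **The language $\mathtt{Gen}$** has only typed terms (types are formulas of $L$). $\mathrm{TERM}_{\mathtt{Gen}}$ is the smallest set with the following closure conditions (writing $T:\alpha$ for ''$T$ is a term of type $\alpha$''; bound variables are written after the operational symbol): - a constant $\delta:\alpha$ for each derivation in $\mathrm{DER}_{\mathtt{S}}$ with no undischarged assumptions and no unbound variables, $\alpha$ being its conclusion; - typed-variables $\xi^\alpha_i:\alpha$ ($\alpha\in\mathrm{FORM}_L$, $i\in\mathbb{N}$; indices are often omitted); - if $T:\alpha$, $U:\beta$ then $\wedge I(T,U):\alpha\wedge\beta$; if $T:\alpha_1\wedge\alpha_2$ then $\wedge_{E,i}(T):\alpha_i$ ($i=1,2$); - if $T:\alpha_i$ then $\vee I[\alpha_i\rhd\alpha_1\vee\alpha_2](T):\alpha_1\vee\alpha_2$; if $T:\alpha\vee\beta$, $U:\gamma$, $Z:\gamma$ then $\vee E\,\xi^\alpha\,\xi^\beta(T,U,Z):\gamma$ (binding $\xi^\alpha$ in $U$ and $\xi^\beta$ in $Z$); - if $T:\beta$ then $\to\! I\,\xi^\alpha(T):\alpha\to\beta$ (binding $\xi^\alpha$); if $T:\alpha\to\beta$, $U:\alpha$ then $\to\! E(T,U):\beta$; - if $U:\alpha(x)$ then $\forall I\,x(U):\forall y\,\alpha(y)$ (binding $x$), provided $x\notin FV(\gamma)$ for every $\xi^\gamma\in FV^T(U)$; if $T:\forall x\,\alpha(x)$ then $\forall E[\forall x\alpha(x)\rhd\alpha(t)](T):\alpha(t)$, $t$ free for $x$ in $\alpha(x)$;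 - if $T:\alpha(t)$ then $\exists I[\alpha(t)\rhd\exists x\alpha(x)](T):\exists x\,\alpha(x)$, $t$ free for $x$ in $\alpha(x)$; if $T:\exists x\,\alpha(x)$, $U:\beta$ then $\exists E\,y\,\xi^{\alpha(y)}(T,U):\beta$ (binding $y$ and $\xi^{\alpha(y)}$ in $U$), provided $y\notin FV(\beta)$ and $y\notin FV(\gamma)$ for every $\xi^\gamma\in FV^T(U)$ with $\gamma\neq\alpha(y)$; - if $T:\bot$ then $\bot_\alpha(T):\alpha$. Operational types in square brackets are often omitted; $\forall E(\xi^{\forall x\alpha(x)})$ of type $\alpha(t)$ stands for $\forall E[\forall x\alpha(x)\rhd\alpha(t)](\xi^{\forall x\alpha(x)})$. $FV^I(T)$, $FV^T(T)$ are the sets of free individual variables and free typed-variables of $T$. Individual variables occur in a term via the types of its typed-variables and the operational types. Substitutions of individual terms for individual variables (also acting on types of typed-variables) and of terms $W:\alpha$ for $\xi^\alpha$ are capture-avoiding. $T(\xi^\alpha)$, $T(U)$, $T(x)$, $T(t)$ have the usual meaning with respect to such substitutions. **The enriched language $\mathtt{Gen}^\varepsilon$** adds functional variables $\mathtt{h}^\alpha_x$ and $\mathtt{f}^\alpha$ (countably many of each kind, for each $\alpha\in\mathrm{FORM}_L$), binary predicates $Gr$ and $\equiv$, and logical constants $\times$ (and), $+$ (or), $\supset$ (implies), $\Pi$ (for all), $\mathfrak{E}$ (exists), $\bot^G$ (absurdity). New terms: $\mathtt{h}^\alpha_x(t):\alpha(t/x)$ for $t\in\mathrm{TERM}_L$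 and $\mathtt{f}^\alpha(T):\alpha$ for $T\in\mathrm{TERM}_{\mathtt{Gen}}$; terms are closed under the operational symbols as before. Atomic formulas: $Gr(T,\alpha)$ for $T$ a term of type $\alpha$, written $T:\alpha$; $T\equiv U$ for $T,U$ terms of the same type; $\bot^G$. Formulas are built with $\times,+,\supset$ and with $\Pi\nu$, $\mathfrak{E}\nu$, $\nu$ any individual, typed- or functional variable. Substitution for functional variables: $\mathtt{h}^\beta_x(t)[U/\mathtt{h}^\beta_x]=U[t/x]$ for $U:\beta$ with $x\notin FV(\alpha)$ for all $\xi^\alpha\in FV^T(U)$, and $\mathtt{f}^\alpha(Z)[U/\mathtt{f}^\alpha]=U$ for $U:\alpha$; terms substituted for typed- and functional variables must belong to $\mathrm{TERM}_{\mathtt{Gen}}$. **The system $\mathtt{GG}$** is a natural deduction system; any formula of $\mathtt{Gen}^\varepsilon$ may be assumed. Its rules are as follows. *Type introductions.* Axiom $\delta:\alpha$ for each constant $\delta$ naming a derivation with conclusion $\alpha$. From $T:\alpha$ and $U:\beta$ infer $\wedge I(T,U):\alpha\wedge\beta$. From $T:\alpha_i$ infer $\vee I[\alpha_i\rhd\alpha_1\vee\alpha_2](T):\alpha_1\vee\alpha_2$. From a derivation of $T(\xi^\alpha):\beta$ from $\xi^\alpha:\alpha$ infer $\to\! I\,\xi^\alpha(T(\xi^\alpha)):\alpha\to\beta$, discharging $\xi^\alpha:\alpha$ ($\xi^\alpha$ not free in other undischarged assumptions). From $T(x):\alpha(x)$ infer $\forall I\,y(T(y/x)):\forall y\,\alpha(y/x)$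 ($x$ not free in undischarged assumptions). From $T:\alpha(t/x)$ infer $\exists I[\alpha(t/x)\rhd\exists x\alpha(x)](T):\exists x\,\alpha(x)$. *Type eliminations* (in each case infer $A$ from the major premise and the derivation(s) of $A$ from the listed dischargeable assumptions): - $D_\wedge$: major $T:\alpha\wedge\beta$; discharge $T\equiv\wedge I(\xi^\alpha,\xi^\beta)$, $\xi^\alpha:\alpha$, $\xi^\beta:\beta$. - $D_\vee$: major $T:\alpha\vee\beta$; two minor derivations of $A$, one discharging $T\equiv\vee I(\xi^\alpha)$, $\xi^\alpha:\alpha$, the other $T\equiv\vee I(\xi^\beta)$, $\xi^\beta:\beta$. - $D_\to$: major $T:\alpha\to\beta$; discharge $T\equiv\;\to\! I\,\xi^\alpha(\mathtt{f}^\beta(\xi^\alpha))$, $\Pi\xi^\alpha(\xi^\alpha:\alpha\supset\mathtt{f}^\beta(\xi^\alpha):\beta)$. - $D_\forall$: major $T:\forall x\,\alpha(x)$; discharge $T\equiv\forall I\,x(\mathtt{h}^{\alpha(x)}_x(x))$, $\Pi x(\mathtt{h}^{\alpha(x)}_x(x):\alpha(x))$. - $D_\exists$: major $T:\exists x\,\alpha(x)$; discharge $T\equiv\exists I(\xi^{\alpha(x)})$, $\xi^{\alpha(x)}:\alpha(x)$. - $\bot$: from $T:\bot$ infer $\bot^G$. The proper variables ($\xi^\alpha,\xi^\beta$ in $D_\wedge$, $D_\vee$; $\mathtt{f}^\beta$ in $D_\to$; $\mathtt{h}^{\alpha(x)}_x$ in $D_\forall$, also after replacing $x$ by any $t$;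 $x$ and $\xi^{\alpha(x)}$ in $D_\exists$) must not be free in $A$ or in undischarged assumptions on which the minor premise $A$ depends other than those discharged by the rule. *Equivalence rules.* Axiom $T\equiv T$; symmetry; transitivity; preservation of denotation ($\equiv_P$): from $T\equiv U$ and $U:\alpha$ infer $T:\alpha$. Congruence: for each operational symbol of $\mathtt{Gen}$ listed above ($\wedge I$, $\wedge_{E,i}$, $\vee I$, $\vee E$, $\to\! I$, $\to\! E$, $\forall I$, $\forall E$, $\exists I$, $\exists E$, with the same bound variables on both sides), from equivalence of corresponding arguments infer equivalence of the resulting terms. Injectivity for primitive symbols: from $\wedge I(T_1,T_2)\equiv\wedge I(U_1,U_2)$ infer $T_i\equiv U_i$; from $sI(T)\equiv sI(U)$ infer $T\equiv U$, for $sI$ one of $\vee I[\alpha_i\rhd\alpha_1\vee\alpha_2]$, $\to\! I\,\xi^\alpha$, $\forall I\,x$, $\exists I$. Equations (axioms): $\wedge_{E,i}(\wedge I(T_1,T_2))\equiv T_i$; $\vee E\,\xi^{\alpha_1}\xi^{\alpha_2}(\vee I[\alpha_i\rhd\alpha_1\vee\alpha_2](T),U_1(\xi^{\alpha_1}),U_2(\xi^{\alpha_2}))\equiv U_i(T)$; $\to\! E(\to\! I\,\xi^\alpha(T(\xi^\alpha)),U)\equiv T(U)$; $\forall E[\forall x\alpha(x)\rhd\alpha(t/x)](\forall I\,x(T(x)))\equiv T(t)$; $\exists E\,x\,\xi^{\alpha(x)}(\exists I[\alpha(t/x)\rhd\exists x\alpha(x)](T),U(x,\xi^{\alpha(x)}))\equiv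 U(t,T)$. (Here the terms may contain functional variables; e.g. $\mathtt{f}^\beta(\xi^\alpha)$ is a case of $U(\xi^\alpha)$, with $\mathtt{f}^\beta(\xi^\alpha)[W/\xi^\alpha]=\mathtt{f}^\beta(W)$.) *Logic.* Gentzen's introduction and elimination rules of first-order intuitionistic natural deduction for $\times,+,\supset,\Pi,\mathfrak{E}$, and from $\bot^G$ infer any $A$. Quantifier rules apply to individual, typed- and functional variables, with the usual proper-variable restrictions; the instantiating term $\tau$ in $\Pi$-elimination and $\mathfrak{E}$-introduction is a term of $L$ or of $\mathtt{Gen}$ (or the quantified variable itself), of type $\alpha$ if the variable is $\xi^\alpha$ or $\mathtt{f}^\alpha$, and, if the variable is $\mathtt{h}^\beta_x$, of type $\beta$ with $x\notin FV(\alpha)$ for all $\xi^\alpha\in FV^T(\tau)$. *)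

(* Defs.v *)
From HB Require Import structures.
From Stdlib Require List.
From mathcomp Require Import all_boot.

Set Implicit Arguments.
Unset Strict Implicit.
Unset Printing Implicit Defensive.

(* Bound variables are nameless (one family of de Bruijn indices for each of
   the four sorts of variables) and free variables are named, so that
   expressions differing by the names of their bound variables are equal.
   Every binder is used through a constructor on names that first abstracts
   the bound name (fAll, fEx, impI, orE, allI, exE, Pi, Sig below), and all
   the inductive definitions below are phrased with these.  Substitution
   cannot capture, so that "t is free for x in A" always holds, possibly after
   renaming bound variables of A. *)

(* ---- The background language ---- *)

(* The countType structures provide the numbering of the symbols with respect
   to which sets of rules are recursively axiomatisable. *)
Record language := Language {
  iconst : countType;
  fsymb : countType;
  farity : fsymb -> nat;
  rsymb : countType;
  rarity : rsymb -> nat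
}.

Inductive tm (L : language) : Type :=
| Bv of nat
| Fv of nat
| Cn of iconst L
| Fn of fsymb L & seq (tm L).

Arguments Bv {L} _.
Arguments Fv {L} _.

Inductive fm (L : language) : Type :=
| fBot
| fRel of rsymb L & seq (tm L)
| fAnd of fm L & fm L
| fOr of fm L & fm L
| fImp of fm L & fm L
| fAllB of fm L
| fExB of fm L.

Arguments fBot {L}.

(* Goedel numbering of terms and formulas: trees over nat, numbered by
   GenTree. *)

Fixpoint tm_enc (L : language) (t : tm L) : GenTree.tree nat :=
  match t with
  | Bv k => GenTree.Node 0 [:: GenTree.Leaf k]
  | Fv x => GenTree.Node 1 [:: GenTree.Leaf x]
  | Cn c => GenTree.Node 2 [:: GenTree.Leaf (pickle c)]
  | Fn f ts => GenTree.Node 3 (GenTree.Leaf (pickle f) :: map (@tm_enc L) ts)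
  end.

Fixpoint tm_dec (L : language) (u : GenTree.tree nat) : option (tm L) :=
  match u with
  | GenTree.Node 0 [:: GenTree.Leaf k] => Some (Bv k)
  | GenTree.Node 1 [:: GenTree.Leaf x] => Some (Fv x)
  | GenTree.Node 2 [:: GenTree.Leaf c] => omap (@Cn L) (unpickle c)
  | GenTree.Node 3 (GenTree.Leaf f :: us) =>
      omap (fun g => Fn g (pmap (@tm_dec L) us)) (unpickle f)
  | _ => None
  end.

Lemma tm_nind (L : language) (P : tm L -> Prop) :
  (forall k, P (Bv k)) -> (forall x, P (Fv x)) -> (forall c, P (Cn c)) ->
  (forall f ts, foldr (fun t => and (P t)) True ts -> P (Fn f ts)) ->
  forall t, P t.
Proof.
move=> Hb Hv Hc Hf; fix IH 1; case=> [k|x|c|f ts].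
- exact: Hb.
- exact: Hv.
- exact: Hc.
by apply: Hf; elim: ts => //= t ts IHts; split.
Qed.

Lemma tm_encK (L : language) : pcancel (@tm_enc L) (@tm_dec L).
Proof.
elim/tm_nind=> //= [c|f ts IH]; first by rewrite pickleK.
rewrite pickleK /=; congr (Some (Fn _ _)).
by elim: ts IH => //= t ts IHts [-> /IHts ->].
Qed.

HB.instance Definition _ (L : language) :=
  Countable.copy (tm L) (pcan_type (@tm_encK L)).

Fixpoint fm_enc (L : language) (A : fm L) : GenTree.tree nat :=
  match A with
  | fBot => GenTree.Node 0 [::]
  | fRel r ts => GenTree.Node 1 (GenTree.Leaf (pickle r) :: map (@tm_enc L) ts)
  | fAnd A B => GenTree.Node 2 [:: fm_enc A; fm_enc B]
  | fOr A B => GenTree.Node 3 [:: fm_enc A; fm_enc B]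
  | fImp A B => GenTree.Node 4 [:: fm_enc A; fm_enc B]
  | fAllB A => GenTree.Node 5 [:: fm_enc A]
  | fExB A => GenTree.Node 6 [:: fm_enc A]
  end.

Fixpoint fm_dec (L : language) (u : GenTree.tree nat) : option (fm L) :=
  match u with
  | GenTree.Node 0 [::] => Some fBot
  | GenTree.Node 1 (GenTree.Leaf r :: us) =>
      omap (fun r => fRel r (pmap (@tm_dec L) us)) (unpickle r)
  | GenTree.Node 2 [:: u; v] =>
      obind (fun A => omap (fAnd A) (fm_dec L v)) (fm_dec L u)
  | GenTree.Node 3 [:: u; v] =>
      obind (fun A => omap (fOr A) (fm_dec L v)) (fm_dec L u)
  | GenTree.Node 4 [:: u; v] =>
      obind (fun A => omap (fImp A) (fm_dec L v)) (fm_dec L u)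
  | GenTree.Node 5 [:: u] => omap (@fAllB L) (fm_dec L u)
  | GenTree.Node 6 [:: u] => omap (@fExB L) (fm_dec L u)
  | _ => None
  end.

Lemma fm_encK (L : language) : pcancel (@fm_enc L) (@fm_dec L).
Proof.
elim=> //= [r ts|A IA B IB|A IA B IB|A IA B IB|A IA|A IA].
- by rewrite pickleK /= (map_pK (@tm_encK L)).
- by rewrite IA /= IB.
- by rewrite IA /= IB.
- by rewrite IA /= IB.
- by rewrite IA.
- by rewrite IA.
Qed.

HB.instance Definition _ (L : language) :=
  Countable.copy (fm L) (pcan_type (@fm_encK L)).

Fixpoint tm_fv (L : language) (t : tm L) : seq nat :=
  match t with
  | Fv x => [:: x]
  | Fn _ ts => flatten (map (@tm_fv L) ts)
  | _ => [::]
  end.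

Fixpoint fm_fv (L : language) (A : fm L) : seq nat :=
  match A with
  | fBot => [::]
  | fRel _ ts => flatten (map (@tm_fv L) ts)
  | fAnd A B | fOr A B | fImp A B => fm_fv A ++ fm_fv B
  | fAllB A | fExB A => fm_fv A
  end.

Fixpoint tm_lift (L : language) (k : nat) (t : tm L) : tm L :=
  match t with
  | Bv j => Bv (k + j)
  | Fn f ts => Fn f (map (tm_lift k) ts)
  | _ => t
  end.

(* Replacement of the name x by t below k binders; t may have dangling
   indices, which are lifted.  Abstracting x is replacing x by Bv 0. *)
Fixpoint tm_repl (L : language) (k x : nat) (t u : tm L) : tm L :=
  match u with
  | Fv y => if y == x then tm_lift k t else u
  | Fn f us => Fn f (map (tm_repl k x t) us)
  | _ => u
  end.

Fixpoint fm_repl (L : language) (k x : nat) (t : tm L) (A : fm L) : fm L :=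
  match A with
  | fBot => fBot
  | fRel r ts => fRel r (map (tm_repl k x t) ts)
  | fAnd A B => fAnd (fm_repl k x t A) (fm_repl k x t B)
  | fOr A B => fOr (fm_repl k x t A) (fm_repl k x t B)
  | fImp A B => fImp (fm_repl k x t A) (fm_repl k x t B)
  | fAllB A => fAllB (fm_repl k.+1 x t A)
  | fExB A => fExB (fm_repl k.+1 x t A)
  end.

Definition fm_subst (L : language) (x : nat) (t : tm L) (A : fm L) : fm L :=
  fm_repl 0 x t A.
Definition fm_abs (L : language) (x : nat) (A : fm L) : fm L :=
  fm_repl 0 x (Bv 0) A.

Definition fAll (L : language) (x : nat) (A : fm L) : fm L := fAllB (fm_abs x A).
Definition fEx (L : language) (x : nat) (A : fm L) : fm L := fExB (fm_abs x A).

Record sublanguage (L : language) := Sublanguage {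
  sub_iconst : iconst L -> Prop;
  sub_fsymb : fsymb L -> Prop;
  sub_rsymb : rsymb L -> Prop
}.

Definition whole (L : language) : sublanguage L :=
  Sublanguage (fun _ => True) (fun _ => True) (fun _ => True).

Inductive TERM_in (L : language) (M : sublanguage L) : tm L -> Prop :=
| TERM_var x : TERM_in M (Fv x)
| TERM_const c : sub_iconst M c -> TERM_in M (Cn c)
| TERM_fun f ts : sub_fsymb M f -> size ts = farity f ->
    List.Forall (TERM_in M) ts -> TERM_in M (Fn f ts).

Inductive ATOM_in (L : language) (M : sublanguage L) : fm L -> Prop :=
| ATOM_bot : ATOM_in M fBot
| ATOM_rel r ts : sub_rsymb M r -> size ts = rarity r ->
    List.Forall (TERM_in M) ts -> ATOM_in M (fRel r ts).

Definition TERM (L : language) : tm L -> Prop := TERM_in (whole L).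
Definition ATOM (L : language) : fm L -> Prop := ATOM_in (whole L).

Inductive FORM (L : language) : fm L -> Prop :=
| FORM_atom A : ATOM A -> FORM A
| FORM_and A B : FORM A -> FORM B -> FORM (fAnd A B)
| FORM_or A B : FORM A -> FORM B -> FORM (fOr A B)
| FORM_imp A B : FORM A -> FORM B -> FORM (fImp A B)
| FORM_all x A : FORM A -> FORM (fAll x A)
| FORM_ex x A : FORM A -> FORM (fEx x A).

(* ---- Atomic systems and bases ---- *)

(* Partial recursive functions, on argument lists of any length. *)
Inductive recfun : Type :=
| RZero
| RSucc
| RProj of nat
| RComp of recfun & seq recfun
| RPrec of recfun & recfun
| RMin of recfun.

Inductive reval : recfun -> seq nat -> nat -> Prop :=
| reval_zero xs : reval RZero xs 0
| reval_succ x xs : reval RSucc (x :: xs) x.+1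
| reval_proj i xs : i < size xs -> reval (RProj i) xs (nth 0 xs i)
| reval_comp f gs xs ys z :
    revals gs xs ys -> reval f ys z -> reval (RComp f gs) xs z
| reval_prec0 f g xs z : reval f xs z -> reval (RPrec f g) (0 :: xs) z
| reval_precS f g n xs y z :
    reval (RPrec f g) (n :: xs) y -> reval g [:: n, y & xs] z ->
    reval (RPrec f g) (n.+1 :: xs) z
| reval_min f n xs :
    reval f (n :: xs) 0 ->
    (forall m, m < n -> exists y, reval f (m :: xs) y.+1) ->
    reval (RMin f) xs n
with revals : seq recfun -> seq nat -> seq nat -> Prop :=
| revals_nil xs : revals [::] xs [::]
| revals_cons g gs xs y ys :
    reval g xs y -> revals gs xs ys -> revals (g :: gs) xs (y :: ys).

Definition rec_enumerable (P : nat -> Prop) : Prop :=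
  exists f, forall n, P n <-> exists y, reval f [:: n] y.

(* (premises, conclusion) *)
Definition rule (L : language) : Type := (seq (fm L) * fm L)%type.

(* Recursive axiomatisability is stated as recursive enumerability of the set
   of Goedel numbers of the rules. *)
Record atomic_system (L : language) := AtomicSystem {
  sys_lang : sublanguage L;
  sys_rules : rule L -> Prop;
  sys_rec : rec_enumerable (fun n => exists2 r, sys_rules r & n = pickle r);
  sys_prem : forall r, sys_rules r ->
    List.Forall (fun A => ATOM_in sys_lang A /\ A <> fBot) r.1;
  sys_concl : forall r, sys_rules r -> ATOM_in sys_lang r.2;
  sys_vars : forall r, sys_rules r ->
    {subset fm_fv r.2 <= flatten (map (@fm_fv L) r.1)}
}.

Inductive der (L : language) : Type :=
| DAss of fm L
| DApp of rule L & seq (der L).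

Definition der_concl (L : language) (d : der L) : fm L :=
  match d with DAss A => A | DApp r _ => r.2 end.

Fixpoint der_assumptions (L : language) (d : der L) : seq (fm L) :=
  match d with
  | DAss A => [:: A]
  | DApp _ ds => flatten (map (@der_assumptions L) ds)
  end.

Fixpoint der_fv (L : language) (d : der L) : seq nat :=
  match d with
  | DAss A => fm_fv A
  | DApp r ds => fm_fv r.2 ++ flatten (map (@der_fv L) ds)
  end.

Inductive DER (L : language) (S : atomic_system L) : der L -> Prop :=
| DER_ass A : ATOM_in (sys_lang S) A -> DER S (DAss A)
| DER_app r ds : sys_rules S r -> List.Forall (DER S) ds ->
    map (@der_concl L) ds = r.1 -> DER S (DApp r ds).

(* The first two components of the triple are determined by L. *)
Record atomic_base (L : language) := AtomicBase {
  base_iconst : countType := iconst L;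
  base_rsymb : countType := rsymb L;
  base_sys : atomic_system L
}.

Definition closed_der (L : language) (B : atomic_base L) (d : der L) : Prop :=
  [/\ DER (base_sys B) d, der_assumptions d = [::] & der_fv d = [::]].

(* ---- Terms of Gen and of its enrichment ---- *)

Inductive side := Fst | Snd.
Definition sel (A : Type) (i : side) (a1 a2 : A) : A :=
  match i with Fst => a1 | Snd => a2 end.

(* A typed- or functional variable: a free one is given by its index and its
   type, a bound one is a de Bruijn index. *)
Inductive nvar (L : language) : Type :=
| Free of nat & fm L
| Bound of nat.

Arguments Bound {L} _.

(* In gAllE, gExI and gExE, and in the type of the variable of a gH, the
   formula has the quantified variable as dangling index 0.  The operational
   type [forall x A(x) > A(t)] is recorded by A and t. *)
Inductive gt (L : language) : Type :=
| gD of der L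
| gV of nvar L
| gAndI of gt L & gt L
| gAndE of side & gt L
| gOrI of side & fm L & fm L & gt L
| gOrE of fm L & fm L & gt L & gt L & gt L
| gImpI of fm L & gt L
| gImpE of gt L & gt L
| gAllI of gt L
| gAllE of fm L & tm L & gt L
| gExI of fm L & tm L & gt L
| gExE of fm L & gt L & gt L
| gBot of fm L & gt L
| gH of nvar L & tm L
| gF of nvar L & gt L.

Definition nvar_repl (L : language) (k x : nat) (t : tm L) (v : nvar L) :=
  match v with Free i A => Free i (fm_repl k x t A) | Bound j => Bound j end.

Fixpoint gt_repl (L : language) (k x : nat) (t : tm L) (T : gt L) : gt L :=
  match T with
  | gD d => gD d
  | gV v => gV (nvar_repl k x t v)
  | gAndI T U => gAndI (gt_repl k x t T) (gt_repl k x t U)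
  | gAndE i T => gAndE i (gt_repl k x t T)
  | gOrI i A1 A2 T => gOrI i (fm_repl k x t A1) (fm_repl k x t A2) (gt_repl k x t T)
  | gOrE A1 A2 T U Z =>
      gOrE (fm_repl k x t A1) (fm_repl k x t A2)
           (gt_repl k x t T) (gt_repl k x t U) (gt_repl k x t Z)
  | gImpI A T => gImpI (fm_repl k x t A) (gt_repl k x t T)
  | gImpE T U => gImpE (gt_repl k x t T) (gt_repl k x t U)
  | gAllI T => gAllI (gt_repl k.+1 x t T)
  | gAllE A s T => gAllE (fm_repl k.+1 x t A) (tm_repl k x t s) (gt_repl k x t T)
  | gExI A s T => gExI (fm_repl k.+1 x t A) (tm_repl k x t s) (gt_repl k x t T)
  | gExE A T U => gExE (fm_repl k.+1 x t A) (gt_repl k x t T) (gt_repl k.+1 x t U)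
  | gBot A T => gBot (fm_repl k x t A) (gt_repl k x t T)
  | gH v s => gH (nvar_repl k.+1 x t v) (tm_repl k x t s)
  | gF v T => gF (nvar_repl k x t v) (gt_repl k x t T)
  end.

(* Replacement of typed- and functional variables; k counts the typed-variable
   binders crossed (functional variables are only bound in formulas). *)
Fixpoint gt_map (L : language) (gT : nat -> nvar L -> gt L)
    (gHf : nvar L -> tm L -> gt L) (gFf : nvar L -> gt L -> gt L)
    (k : nat) (T : gt L) : gt L :=
  match T with
  | gD d => gD d
  | gV v => gT k v
  | gAndI T U => gAndI (gt_map gT gHf gFf k T) (gt_map gT gHf gFf k U)
  | gAndE i T => gAndE i (gt_map gT gHf gFf k T)
  | gOrI i A1 A2 T => gOrI i A1 A2 (gt_map gT gHf gFf k T)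
  | gOrE A1 A2 T U Z =>
      gOrE A1 A2 (gt_map gT gHf gFf k T)
           (gt_map gT gHf gFf k.+1 U) (gt_map gT gHf gFf k.+1 Z)
  | gImpI A T => gImpI A (gt_map gT gHf gFf k.+1 T)
  | gImpE T U => gImpE (gt_map gT gHf gFf k T) (gt_map gT gHf gFf k U)
  | gAllI T => gAllI (gt_map gT gHf gFf k T)
  | gAllE A s T => gAllE A s (gt_map gT gHf gFf k T)
  | gExI A s T => gExI A s (gt_map gT gHf gFf k T)
  | gExE A T U => gExE A (gt_map gT gHf gFf k T) (gt_map gT gHf gFf k.+1 U)
  | gBot A T => gBot A (gt_map gT gHf gFf k T)
  | gH v s => gHf v s
  | gF v T => gFf v (gt_map gT gHf gFf k T)
  end.

Definition is_free (L : language) (i : nat) (A : fm L) (v : nvar L) : bool :=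
  match v with Free j C => (j == i) && (C == A) | Bound _ => false end.

Definition repT (L : language) (i : nat) (A : fm L) (w : nat -> gt L)
    (k : nat) (v : nvar L) : gt L :=
  if is_free i A v then w k else gV v.

Definition gt_subst (L : language) (x : nat) (t : tm L) (T : gt L) : gt L :=
  gt_repl 0 x t T.
Definition gt_abs (L : language) (x : nat) (T : gt L) : gt L :=
  gt_repl 0 x (Bv 0) T.
Definition gt_substT (L : language) (i : nat) (A : fm L) (W T : gt L) : gt L :=
  gt_map (repT i A (fun _ => W)) (@gH L) (@gF L) 0 T.
Definition gt_absT (L : language) (i : nat) (A : fm L) (T : gt L) : gt L :=
  gt_map (repT i A (fun k => gV (Bound k))) (@gH L) (@gF L) 0 T.
Definition gt_instT (L : language) (W T : gt L) : gt L :=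
  gt_map (fun k v => match v with
                     | Bound j => if j == k then W else gV v
                     | Free _ _ => gV v
                     end) (@gH L) (@gF L) 0 T.

(* U(t,T) for U(x,xi^A(x)): x and xi are replaced simultaneously, so that t is
   not substituted into T, and xi is not confused with a variable xi^A(t). *)
Definition gt_subst2 (L : language) (x : nat) (t : tm L) (i : nat) (A : fm L)
    (T U : gt L) : gt L :=
  gt_instT T (gt_subst x t (gt_absT i A U)).

Definition xi (L : language) (i : nat) (A : fm L) : gt L := gV (Free i A).
Definition hvar (L : language) (i x : nat) (A : fm L) (t : tm L) : gt L :=
  gH (Free i (fm_abs x A)) t.
Definition fvar (L : language) (i : nat) (A : fm L) (T : gt L) : gt L :=
  gF (Free i A) T.
Definition orE (L : language) (i : nat) (A : fm L) (j : nat) (B : fm L)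
    (T U Z : gt L) : gt L :=
  gOrE A B T (gt_absT i A U) (gt_absT j B Z).
Definition impI (L : language) (i : nat) (A : fm L) (T : gt L) : gt L :=
  gImpI A (gt_absT i A T).
Definition allI (L : language) (x : nat) (T : gt L) : gt L := gAllI (gt_abs x T).
(* forall E[forall x A > A(t/x)](T) *)
Definition allE (L : language) (x : nat) (A : fm L) (t : tm L) (T : gt L) : gt L :=
  gAllE (fm_abs x A) t T.
(* exists I[A(t/x) > exists x A](T) *)
Definition exI (L : language) (x : nat) (A : fm L) (t : tm L) (T : gt L) : gt L :=
  gExI (fm_abs x A) t T.
Definition exE (L : language) (y i : nat) (A : fm L) (T U : gt L) : gt L :=
  gExE (fm_abs y A) T (gt_abs y (gt_absT i A U)).

(* The variables of the enriched language; in VH i A the formula A has the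
   subscript variable as dangling index 0. *)
Inductive var (L : language) : Type :=
| VI of nat
| VT of nat & fm L
| VH of nat & fm L
| VF of nat & fm L.

Arguments VI {L} _.

Definition hV (L : language) (i x : nat) (A : fm L) : var L := VH i (fm_abs x A).

Definition fm_fvI (L : language) (A : fm L) : seq (var L) := map VI (fm_fv A).
Definition tm_fvI (L : language) (t : tm L) : seq (var L) := map VI (tm_fv t).

Definition nvar_fv (L : language) (V : nat -> fm L -> var L) (v : nvar L) :=
  match v with Free i A => V i A :: fm_fvI A | Bound _ => [::] end.

Fixpoint gt_fv (L : language) (T : gt L) : seq (var L) :=
  match T with
  | gD _ => [::]
  | gV v => nvar_fv (@VT L) v
  | gAndI T U | gImpE T U => gt_fv T ++ gt_fv U
  | gAndE _ T | gAllI T => gt_fv T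
  | gOrI _ A1 A2 T => fm_fvI A1 ++ fm_fvI A2 ++ gt_fv T
  | gOrE A1 A2 T U Z => fm_fvI A1 ++ fm_fvI A2 ++ gt_fv T ++ gt_fv U ++ gt_fv Z
  | gImpI A T | gBot A T => fm_fvI A ++ gt_fv T
  | gAllE A t T | gExI A t T => fm_fvI A ++ tm_fvI t ++ gt_fv T
  | gExE A T U => fm_fvI A ++ gt_fv T ++ gt_fv U
  | gH v t => nvar_fv (@VH L) v ++ tm_fvI t
  | gF v T => nvar_fv (@VF L) v ++ gt_fv T
  end.

Definition not_in_types (L : language) (x : nat) (T : gt L) : Prop :=
  forall i C, List.In (VT i C) (gt_fv T) -> x \notin fm_fv C.

(* "T is a term of type A": of Gen for e = false, of the enriched language for
   e = true. *)
Inductive typed (L : language) (B : atomic_base L) (e : bool) :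
    gt L -> fm L -> Prop :=
| ty_const d : closed_der B d -> typed B e (gD d) (der_concl d)
| ty_var i A : FORM A -> typed B e (xi i A) A
| ty_andI T U A1 A2 : typed B e T A1 -> typed B e U A2 ->
    typed B e (gAndI T U) (fAnd A1 A2)
| ty_andE s T A1 A2 : typed B e T (fAnd A1 A2) ->
    typed B e (gAndE s T) (sel s A1 A2)
| ty_orI s T A1 A2 : FORM A1 -> FORM A2 -> typed B e T (sel s A1 A2) ->
    typed B e (gOrI s A1 A2 T) (fOr A1 A2)
| ty_orE i j T U Z A1 A2 C : typed B e T (fOr A1 A2) ->
    typed B e U C -> typed B e Z C -> typed B e (orE i A1 j A2 T U Z) C
| ty_impI i T A1 A2 : FORM A1 -> typed B e T A2 ->
    typed B e (impI i A1 T) (fImp A1 A2)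
| ty_impE T U A1 A2 : typed B e T (fImp A1 A2) -> typed B e U A1 ->
    typed B e (gImpE T U) A2
| ty_allI x U A : typed B e U A -> not_in_types x U ->
    typed B e (allI x U) (fAll x A)
| ty_allE x A t T : FORM A -> TERM t -> typed B e T (fAll x A) ->
    typed B e (allE x A t T) (fm_subst x t A)
| ty_exI x A t T : FORM A -> TERM t -> typed B e T (fm_subst x t A) ->
    typed B e (exI x A t T) (fEx x A)
| ty_exE y i A C T U : FORM A -> typed B e T (fEx y A) -> typed B e U C ->
    y \notin fm_fv C ->
    (forall j D, List.In (VT j D) (gt_fv U) -> D <> A -> y \notin fm_fv D) ->
    typed B e (exE y i A T U) C
| ty_bot T A : FORM A -> typed B e T fBot -> typed B e (gBot A T) A
| ty_h i x A t : e -> FORM A -> TERM t ->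
    typed B e (hvar i x A t) (fm_subst x t A)
| ty_f i A T C : e -> FORM A -> typed B false T C -> typed B e (fvar i A T) A.

(* ---- Formulas of the enriched language ---- *)

(* The sort of a quantified variable, with its type. *)
Inductive binder (L : language) : Type :=
| BI
| BT of fm L
| BH of fm L
| BF of fm L.

Inductive ef (L : language) : Type :=
| Gr of gt L & fm L
| Equ of gt L & gt L
| BotG
| Times of ef L & ef L
| Plus of ef L & ef L
| Sup of ef L & ef L
| PiB of binder L & ef L
| SigB of binder L & ef L.

Arguments BI {L}.
Arguments BotG {L}.

Definition binder_repl (L : language) (k x : nat) (t : tm L) (b : binder L) :=
  match b with
  | BI => BI
  | BT A => BT (fm_repl k x t A)
  | BH A => BH (fm_repl k.+1 x t A)
  | BF A => BF (fm_repl k x t A)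
  end.

Definition upI (L : language) (b : binder L) (k : nat) :=
  if b is BI then k.+1 else k.
Definition upT (L : language) (b : binder L) (k : nat) :=
  if b is BT _ then k.+1 else k.
Definition upH (L : language) (b : binder L) (k : nat) :=
  if b is BH _ then k.+1 else k.
Definition upF (L : language) (b : binder L) (k : nat) :=
  if b is BF _ then k.+1 else k.

Fixpoint ef_repl (L : language) (k x : nat) (t : tm L) (A : ef L) : ef L :=
  match A with
  | Gr T C => Gr (gt_repl k x t T) (fm_repl k x t C)
  | Equ T U => Equ (gt_repl k x t T) (gt_repl k x t U)
  | BotG => BotG
  | Times A C => Times (ef_repl k x t A) (ef_repl k x t C)
  | Plus A C => Plus (ef_repl k x t A) (ef_repl k x t C)
  | Sup A C => Sup (ef_repl k x t A) (ef_repl k x t C)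
  | PiB b A => PiB (binder_repl k x t b) (ef_repl (upI b k) x t A)
  | SigB b A => SigB (binder_repl k x t b) (ef_repl (upI b k) x t A)
  end.

Fixpoint ef_map (L : language) (gT : nat -> nvar L -> gt L)
    (gHf : nat -> nvar L -> tm L -> gt L) (gFf : nat -> nvar L -> gt L -> gt L)
    (kT kH kF : nat) (A : ef L) : ef L :=
  match A with
  | Gr T C => Gr (gt_map gT (gHf kH) (gFf kF) kT T) C
  | Equ T U =>
      Equ (gt_map gT (gHf kH) (gFf kF) kT T) (gt_map gT (gHf kH) (gFf kF) kT U)
  | BotG => BotG
  | Times A C => Times (ef_map gT gHf gFf kT kH kF A) (ef_map gT gHf gFf kT kH kF C)
  | Plus A C => Plus (ef_map gT gHf gFf kT kH kF A) (ef_map gT gHf gFf kT kH kF C)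
  | Sup A C => Sup (ef_map gT gHf gFf kT kH kF A) (ef_map gT gHf gFf kT kH kF C)
  | PiB b A => PiB b (ef_map gT gHf gFf (upT b kT) (upH b kH) (upF b kF) A)
  | SigB b A => SigB b (ef_map gT gHf gFf (upT b kT) (upH b kH) (upF b kF) A)
  end.

Definition repH (L : language) (i : nat) (A : fm L) (w : nat -> tm L -> gt L)
    (k : nat) (v : nvar L) (t : tm L) : gt L :=
  if is_free i A v then w k t else gH v t.
Definition repF (L : language) (i : nat) (A : fm L) (w : nat -> gt L -> gt L)
    (k : nat) (v : nvar L) (T : gt L) : gt L :=
  if is_free i A v then w k T else gF v T.

Definition ef_mapT (L : language) (g : nat -> nvar L -> gt L) : ef L -> ef L :=
  ef_map g (fun _ => @gH L) (fun _ => @gF L) 0 0 0.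
Definition ef_mapH (L : language) (g : nat -> nvar L -> tm L -> gt L) : ef L -> ef L :=
  ef_map (fun _ => @gV L) g (fun _ => @gF L) 0 0 0.
Definition ef_mapF (L : language) (g : nat -> nvar L -> gt L -> gt L) : ef L -> ef L :=
  ef_map (fun _ => @gV L) (fun _ => @gH L) g 0 0 0.

Definition ef_abs (L : language) (v : var L) (A : ef L) : ef L :=
  match v with
  | VI x => ef_repl 0 x (Bv 0) A
  | VT i C => ef_mapT (repT i C (fun k => gV (Bound k))) A
  | VH i C => ef_mapH (repH i C (fun k t => gH (Bound k) t)) A
  | VF i C => ef_mapF (repF i C (fun k T => gF (Bound k) T)) A
  end.

Definition bind (L : language) (v : var L) : binder L :=
  match v with VI _ => BI | VT _ C => BT C | VH _ C => BH C | VF _ C => BF C end.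

Definition Pi (L : language) (v : var L) (A : ef L) : ef L := PiB (bind v) (ef_abs v A).
Definition Sig (L : language) (v : var L) (A : ef L) : ef L := SigB (bind v) (ef_abs v A).

Definition ef_subst (L : language) (x : nat) (t : tm L) (A : ef L) : ef L :=
  ef_repl 0 x t A.
Definition ef_substT (L : language) (i : nat) (C : fm L) (W : gt L) (A : ef L) : ef L :=
  ef_mapT (repT i C (fun _ => W)) A.
(* h^C_x(t)[U/h^C_x] = U[t/x] *)
Definition ef_substH (L : language) (i x : nat) (C : fm L) (U : gt L) (A : ef L) : ef L :=
  ef_mapH (repH i (fm_abs x C) (fun _ t => gt_subst x t U)) A.
(* f^C(Z)[U/f^C] = U *)
Definition ef_substF (L : language) (i : nat) (C : fm L) (U : gt L) (A : ef L) : ef L :=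
  ef_mapF (repF i C (fun _ _ => U)) A.

Inductive var_ok (L : language) : var L -> Prop :=
| ok_VI x : var_ok (VI x)
| ok_VT i A : FORM A -> var_ok (VT i A)
| ok_VH i x A : FORM A -> var_ok (hV i x A)
| ok_VF i A : FORM A -> var_ok (VF i A).

Inductive EFORM (L : language) (B : atomic_base L) : ef L -> Prop :=
| EF_Gr T A : typed B true T A -> EFORM B (Gr T A)
| EF_Equ T U A : typed B true T A -> typed B true U A -> EFORM B (Equ T U)
| EF_BotG : EFORM B BotG
| EF_Times A C : EFORM B A -> EFORM B C -> EFORM B (Times A C)
| EF_Plus A C : EFORM B A -> EFORM B C -> EFORM B (Plus A C)
| EF_Sup A C : EFORM B A -> EFORM B C -> EFORM B (Sup A C)
| EF_Pi v A : var_ok v -> EFORM B A -> EFORM B (Pi v A)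
| EF_Sig v A : var_ok v -> EFORM B A -> EFORM B (Sig v A).

Definition binder_fv (L : language) (b : binder L) : seq (var L) :=
  match b with BI => [::] | BT A | BH A | BF A => fm_fvI A end.

Fixpoint ef_fv (L : language) (A : ef L) : seq (var L) :=
  match A with
  | Gr T C => gt_fv T ++ fm_fvI C
  | Equ T U => gt_fv T ++ gt_fv U
  | BotG => [::]
  | Times A C | Plus A C | Sup A C => ef_fv A ++ ef_fv C
  | PiB b A | SigB b A => binder_fv b ++ ef_fv A
  end.

(* Instantiation of the indices dangling below k binders. *)
Fixpoint tm_inst (L : language) (s : nat -> tm L) (k : nat) (t : tm L) : tm L :=
  match t with
  | Bv j => if j < k then Bv j else s (j - k)
  | Fn f ts => Fn f (map (tm_inst s k) ts)
  | _ => t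
  end.

Fixpoint fm_inst (L : language) (s : nat -> tm L) (k : nat) (A : fm L) : fm L :=
  match A with
  | fBot => fBot
  | fRel r ts => fRel r (map (tm_inst s k) ts)
  | fAnd A B => fAnd (fm_inst s k A) (fm_inst s k B)
  | fOr A B => fOr (fm_inst s k A) (fm_inst s k B)
  | fImp A B => fImp (fm_inst s k A) (fm_inst s k B)
  | fAllB A => fAllB (fm_inst s k.+1 A)
  | fExB A => fExB (fm_inst s k.+1 A)
  end.

Definition instance_of (L : language) (k : nat) (C A : fm L) : Prop :=
  exists2 s : nat -> tm L, (forall j, TERM (s j)) & A = fm_inst s k C.

(* In Pi x (xi^A(x) : A(x)) the variable xi is free although x is bound in its
   type.  Such an xi counts as an occurrence of every xi^A(t), since these are
   what the instances of the formula are about; likewise for functional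
   variables.  For a variable w whose type has no bound x, this is equality. *)
Definition stands_for (L : language) (w v : var L) : Prop :=
  match w, v with
  | VI x, VI y => x = y
  | VT i C, VT j A | VF i C, VF j A => i = j /\ instance_of 0 C A
  | VH i C, VH j A => i = j /\ instance_of 1 C A
  | _, _ => False
  end.

Definition fresh (L : language) (v : var L) (G : seq (ef L)) : Prop :=
  forall A w, List.In A G -> List.In w (ef_fv A) -> ~ stands_for w v.

(* ---- The system GG ---- *)

(* [instance B v A A']: A' is A[tau/v] for an admissible tau. *)
Inductive instance (L : language) (B : atomic_base L) :
    var L -> ef L -> ef L -> Prop :=
| inst_self v A : instance B v A A
| inst_I x t A : TERM t -> instance B (VI x) A (ef_subst x t A)
| inst_T i C W A : typed B false W C -> instance B (VT i C) A (ef_substT i C W A)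
| inst_H i x C U A : typed B false U C -> not_in_types x U ->
    instance B (hV i x C) A (ef_substH i x C U A)
| inst_F i C U A : typed B false U C -> instance B (VF i C) A (ef_substF i C U A).

(* [GG B G A]: there is a derivation of A whose undischarged assumptions are
   all among G.  Side premises EFORM keep the derivation within the formulas of
   the language.  In the rules with proper variables, D collects the
   assumptions on which the minor premise depends. *)
Inductive GG (L : language) (B : atomic_base L) : seq (ef L) -> ef L -> Prop :=
| gg_assume G A : EFORM B A -> List.In A G -> GG B G A
| gg_weaken G D A : List.incl G D -> GG B G A -> GG B D A

| gg_const G d : closed_der B d -> GG B G (Gr (gD d) (der_concl d))
| gg_andI G T U A1 A2 : GG B G (Gr T A1) -> GG B G (Gr U A2) ->
    GG B G (Gr (gAndI T U) (fAnd A1 A2))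
| gg_orI G s T A1 A2 : FORM A1 -> FORM A2 -> GG B G (Gr T (sel s A1 A2)) ->
    GG B G (Gr (gOrI s A1 A2 T) (fOr A1 A2))
| gg_impI G i T A1 A2 : FORM A1 -> fresh (VT i A1) G ->
    GG B (Gr (xi i A1) A1 :: G) (Gr T A2) ->
    GG B G (Gr (impI i A1 T) (fImp A1 A2))
(* The name y of the conclusion all y A(y/x) does not matter. *)
| gg_allI G x T A : EFORM B (Gr (allI x T) (fAll x A)) -> fresh (VI x) G ->
    GG B G (Gr T A) -> GG B G (Gr (allI x T) (fAll x A))
| gg_exI G x t T A : FORM A -> TERM t -> GG B G (Gr T (fm_subst x t A)) ->
    GG B G (Gr (exI x A t T) (fEx x A))

| gg_Dand G D i j T A1 A2 A : (i, A1) <> (j, A2) ->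
    fresh (VT i A1) (A :: D) -> fresh (VT j A2) (A :: D) ->
    GG B G (Gr T (fAnd A1 A2)) ->
    GG B [:: Equ T (gAndI (xi i A1) (xi j A2)), Gr (xi i A1) A1,
             Gr (xi j A2) A2 & D] A ->
    GG B (G ++ D) A
| gg_Dor G D1 D2 i j T A1 A2 A :
    fresh (VT i A1) (A :: D1) -> fresh (VT j A2) (A :: D2) ->
    GG B G (Gr T (fOr A1 A2)) ->
    GG B [:: Equ T (gOrI Fst A1 A2 (xi i A1)), Gr (xi i A1) A1 & D1] A ->
    GG B [:: Equ T (gOrI Snd A1 A2 (xi j A2)), Gr (xi j A2) A2 & D2] A ->
    GG B (G ++ D1 ++ D2) A
| gg_Dimp G D i j T A1 A2 A : fresh (VF j A2) (A :: D) ->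
    GG B G (Gr T (fImp A1 A2)) ->
    GG B [:: Equ T (impI i A1 (fvar j A2 (xi i A1))),
             Pi (VT i A1) (Sup (Gr (xi i A1) A1) (Gr (fvar j A2 (xi i A1)) A2)) & D] A ->
    GG B (G ++ D) A
| gg_Dall G D j x T C A : FORM C -> fresh (hV j x C) (A :: D) ->
    GG B G (Gr T (fAll x C)) ->
    GG B [:: Equ T (allI x (hvar j x C (Fv x))),
             Pi (VI x) (Gr (hvar j x C (Fv x)) C) & D] A ->
    GG B (G ++ D) A
| gg_Dex G D i x T C A : FORM C ->
    fresh (VI x) (A :: D) -> fresh (VT i C) (A :: D) ->
    GG B G (Gr T (fEx x C)) ->
    GG B [:: Equ T (exI x C (Fv x) (xi i C)), Gr (xi i C) C & D] A ->
    GG B (G ++ D) A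
| gg_bot G T : GG B G (Gr T fBot) -> GG B G BotG

| gg_refl G T A : typed B true T A -> GG B G (Equ T T)
| gg_sym G T U : GG B G (Equ T U) -> GG B G (Equ U T)
| gg_trans G T U Z : GG B G (Equ T U) -> GG B G (Equ U Z) -> GG B G (Equ T Z)
| gg_pres G T U A : EFORM B (Gr T A) -> GG B G (Equ T U) -> GG B G (Gr U A) ->
    GG B G (Gr T A)

| gg_cong_andI G T T' U U' : EFORM B (Equ (gAndI T U) (gAndI T' U')) ->
    GG B G (Equ T T') -> GG B G (Equ U U') ->
    GG B G (Equ (gAndI T U) (gAndI T' U'))
| gg_cong_andE G s T T' : EFORM B (Equ (gAndE s T) (gAndE s T')) ->
    GG B G (Equ T T') -> GG B G (Equ (gAndE s T) (gAndE s T'))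
| gg_cong_orI G s A1 A2 T T' : EFORM B (Equ (gOrI s A1 A2 T) (gOrI s A1 A2 T')) ->
    GG B G (Equ T T') -> GG B G (Equ (gOrI s A1 A2 T) (gOrI s A1 A2 T'))
| gg_cong_orE G i A1 j A2 T T' U U' Z Z' :
    EFORM B (Equ (orE i A1 j A2 T U Z) (orE i A1 j A2 T' U' Z')) ->
    GG B G (Equ T T') -> GG B G (Equ U U') -> GG B G (Equ Z Z') ->
    GG B G (Equ (orE i A1 j A2 T U Z) (orE i A1 j A2 T' U' Z'))
| gg_cong_impI G i A T T' : EFORM B (Equ (impI i A T) (impI i A T')) ->
    GG B G (Equ T T') -> GG B G (Equ (impI i A T) (impI i A T'))
| gg_cong_impE G T T' U U' : EFORM B (Equ (gImpE T U) (gImpE T' U')) ->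
    GG B G (Equ T T') -> GG B G (Equ U U') ->
    GG B G (Equ (gImpE T U) (gImpE T' U'))
| gg_cong_allI G x T T' : EFORM B (Equ (allI x T) (allI x T')) ->
    GG B G (Equ T T') -> GG B G (Equ (allI x T) (allI x T'))
| gg_cong_allE G x A t T T' : EFORM B (Equ (allE x A t T) (allE x A t T')) ->
    GG B G (Equ T T') -> GG B G (Equ (allE x A t T) (allE x A t T'))
| gg_cong_exI G x A t T T' : EFORM B (Equ (exI x A t T) (exI x A t T')) ->
    GG B G (Equ T T') -> GG B G (Equ (exI x A t T) (exI x A t T'))
| gg_cong_exE G y i A T T' U U' :
    EFORM B (Equ (exE y i A T U) (exE y i A T' U')) ->
    GG B G (Equ T T') -> GG B G (Equ U U') ->
    GG B G (Equ (exE y i A T U) (exE y i A T' U'))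

| gg_inj_and G s T1 T2 U1 U2 : GG B G (Equ (gAndI T1 T2) (gAndI U1 U2)) ->
    GG B G (Equ (sel s T1 T2) (sel s U1 U2))
| gg_inj_or G s A1 A2 T U : GG B G (Equ (gOrI s A1 A2 T) (gOrI s A1 A2 U)) ->
    GG B G (Equ T U)
| gg_inj_imp G i A T U : EFORM B (Equ T U) ->
    GG B G (Equ (impI i A T) (impI i A U)) -> GG B G (Equ T U)
| gg_inj_all G x T U : EFORM B (Equ T U) ->
    GG B G (Equ (allI x T) (allI x U)) -> GG B G (Equ T U)
| gg_inj_ex G x A t T U : GG B G (Equ (exI x A t T) (exI x A t U)) ->
    GG B G (Equ T U)

(* A term substituted for a typed-variable belongs to Gen. *)
| gg_eq_and G s T1 T2 :
    EFORM B (Equ (gAndE s (gAndI T1 T2)) (sel s T1 T2)) ->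
    GG B G (Equ (gAndE s (gAndI T1 T2)) (sel s T1 T2))
| gg_eq_or G s i j A1 A2 T U1 U2 : typed B false T (sel s A1 A2) ->
    EFORM B (Equ (orE i A1 j A2 (gOrI s A1 A2 T) U1 U2)
               (sel s (gt_substT i A1 T U1) (gt_substT j A2 T U2))) ->
    GG B G (Equ (orE i A1 j A2 (gOrI s A1 A2 T) U1 U2)
               (sel s (gt_substT i A1 T U1) (gt_substT j A2 T U2)))
| gg_eq_imp G i A T U : typed B false U A ->
    EFORM B (Equ (gImpE (impI i A T) U) (gt_substT i A U T)) ->
    GG B G (Equ (gImpE (impI i A T) U) (gt_substT i A U T))
| gg_eq_all G x A t T : TERM t ->
    EFORM B (Equ (allE x A t (allI x T)) (gt_subst x t T)) ->
    GG B G (Equ (allE x A t (allI x T)) (gt_subst x t T))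
| gg_eq_ex G x i A t T U : TERM t -> typed B false T (fm_subst x t A) ->
    EFORM B (Equ (exE x i A (exI x A t T) U) (gt_subst2 x t i A T U)) ->
    GG B G (Equ (exE x i A (exI x A t T) U) (gt_subst2 x t i A T U))

| gg_timesI G A C : GG B G A -> GG B G C -> GG B G (Times A C)
| gg_timesE G s A C : GG B G (Times A C) -> GG B G (sel s A C)
| gg_plusI G s A C : EFORM B (Plus A C) -> GG B G (sel s A C) -> GG B G (Plus A C)
| gg_plusE G A1 A2 C : GG B G (Plus A1 A2) ->
    GG B (A1 :: G) C -> GG B (A2 :: G) C -> GG B G C
| gg_supI G A C : EFORM B A -> GG B (A :: G) C -> GG B G (Sup A C)
| gg_supE G A C : GG B G (Sup A C) -> GG B G A -> GG B G C
| gg_botE G A : EFORM B A -> GG B G BotG -> GG B G A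
| gg_PiI G v A : var_ok v -> fresh v G -> GG B G A -> GG B G (Pi v A)
| gg_PiE G v A A' : EFORM B A' -> instance B v A A' -> GG B G (Pi v A) -> GG B G A'
| gg_SigI G v A A' : EFORM B (Sig v A) -> instance B v A A' -> GG B G A' ->
    GG B G (Sig v A)
| gg_SigE G D v A C : fresh v (C :: D) -> GG B G (Sig v A) ->
    GG B (A :: D) C -> GG B (G ++ D) C.

(* Main.v *)
(* An eliminatory term applied to a variable is typed by first opening the
   variable with the D-rule of its type: under the assumption that the variable
   is equivalent to a canonical term, congruence and the computation equation
   make the eliminatory term equivalent to a term of the right type, and
   preservation of denotation concludes. *)
Require Import Defs.
From Stdlib Require List.
From mathcomp Require Import all_boot.

Set Implicit Arguments.
Unset Strict Implicit.
Unset Printing Implicit Defensive.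

(** * Substitution: identity, vacuous and abstracting cases, and the contracta *)

Lemma eq_map_nind (L : language) (f g : tm L -> tm L) (ts : seq (tm L)) :
  foldr (fun t => and (f t = g t)) True ts -> map f ts = map g ts.
Proof. by elim: ts => //= t ts IH [-> /IH ->]. Qed.

Lemma tm_lift0 (L : language) (t : tm L) : tm_lift 0 t = t.
Proof.
by elim/tm_nind: t => //= f ts IH; rewrite -[in RHS](map_id ts) (eq_map_nind IH).
Qed.

Lemma tm_repl_id (L : language) (k x : nat) (t : tm L) : tm_repl k x (Fv x) t = t.
Proof.
elim/tm_nind: t => //= [y|f ts IH]; first by case: eqP => [->|].
by rewrite -[in RHS](map_id ts) (eq_map_nind IH).
Qed.

(** Needed for existential types, where the individual term opened by [gg_Dex] is the variable [x]
    itself, so that contraction substitutes [x] for [x]. *)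
Lemma fm_repl_id (L : language) (k x : nat) (A : fm L) : fm_repl k x (Fv x) A = A.
Proof.
elim: A k => //= [r ts|A IA C IC|A IA C IC|A IA C IC|A IA|A IA] k;
  rewrite ?IA ?IC //.
by rewrite -[in RHS](map_id ts) (eq_map (@tm_repl_id _ k x)).
Qed.

Lemma fm_subst_id (L : language) (x : nat) (A : fm L) : fm_subst x (Fv x) A = A.
Proof. exact: fm_repl_id. Qed.

Lemma tm_repl_fresh (L : language) (k x : nat) (t u : tm L) :
  x \notin tm_fv u -> tm_repl k x t u = u.
Proof.
elim/tm_nind: u => //= [y|f us]; first by rewrite inE eq_sym => /negPf ->.
elim: us => //= u us IH [IHu /IH{}IH]; rewrite mem_cat negb_or => /andP[xu xus].
by rewrite IHu //; case: (IH xus) => ->.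
Qed.

Lemma fm_repl_fresh (L : language) (k x : nat) (t : tm L) (A : fm L) :
  x \notin fm_fv A -> fm_repl k x t A = A.
Proof.
elim: A k => //= [r ts|A IA C IC|A IA C IC|A IA C IC|A IA|A IA] k;
  rewrite ?mem_cat ?negb_or; try by [case/andP=> xA xC; rewrite IA ?IC | move=> xA; rewrite IA].
move=> xts; congr fRel.
elim: ts xts => //= u us IH; rewrite mem_cat negb_or => /andP[xu xus].
by rewrite tm_repl_fresh ?IH.
Qed.

Lemma tm_fv_abs (L : language) (k j x : nat) (t : tm L) :
  x \notin tm_fv (tm_repl k x (Bv j) t).
Proof.
elim/tm_nind: t => //= [y|f ts].
  by case: eqP => //= /eqP; rewrite inE eq_sym.
by elim: ts => //= t ts IH [xt /IH]; rewrite mem_cat negb_or xt.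
Qed.

Lemma fm_fv_abs (L : language) (k j x : nat) (A : fm L) :
  x \notin fm_fv (fm_repl k x (Bv j) A).
Proof.
elim: A k => //= [r ts|A IA C IC|A IA C IC|A IA C IC] k;
  rewrite ?mem_cat ?negb_or ?IA ?IC //.
by elim: ts => //= t ts IH; rewrite mem_cat negb_or tm_fv_abs.
Qed.

(** The type carried by the functional variable is abstracted over [x], so [x] survives only in the
    argument. This identifies the contractum of [allE] on the canonical term supplied by
    [gg_Dall]. *)
Lemma hvar_subst (L : language) (j x : nat) (A : fm L) (t : tm L) :
  gt_subst x t (hvar j x A (Fv x)) = hvar j x A t.
Proof. by rewrite /gt_subst /hvar /= eqxx tm_lift0 fm_repl_fresh ?fm_fv_abs. Qed.

(** Gives the contracta of [orE] and [gImpE]: the functional variable stays and its argument is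
    replaced. *)
Lemma fvar_substT (L : language) (i j : nat) (A C : fm L) (W : gt L) :
  gt_substT i A W (fvar j C (xi i A)) = fvar j C W.
Proof. by rewrite /gt_substT /fvar /= /repT /= !eqxx. Qed.

(** * Choice of proper variables *)

Lemma In_cat (T : Type) (x : T) (s1 s2 : seq T) :
  List.In x (s1 ++ s2) -> List.In x s1 \/ List.In x s2.
Proof. exact: List.in_app_or. Qed.

Lemma In_fvI (L : language) (w : var L) (A : fm L) :
  List.In w (fm_fvI A) -> exists2 x, w = VI x & x \in fm_fv A.
Proof.
rewrite /fm_fvI; elim: (fm_fv A) => //= y s IH [<-|/IH[x -> xs]].
  by exists y; rewrite ?mem_head.
by exists x; rewrite // inE xs orbT.
Qed.

Definition var_index (L : language) (v : var L) : nat :=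
  match v with VI x => x | VT i _ | VH i _ | VF i _ => i end.

Lemma stands_for_index (L : language) (w v : var L) :
  stands_for w v -> var_index w = var_index v.
Proof. by case: w v => [x|i A|i A|i A] [y|j C|j C|j C] //= []. Qed.

(** By [stands_for_index], a variable can only stand for one with the same index, whatever their
    types. An index above all those occurring in [G] is therefore fresh for every sort and type at
    once, so no type need be fixed in advance. *)
Lemma exists_fresh_index (L : language) (G : seq (ef L)) :
  exists k, forall v, k <= var_index v -> fresh v G.
Proof.
have In_bound (s : seq (var L)) : exists k, forall w, List.In w s -> var_index w < k.
  elim: s => [|v s [k ks]]; first by exists 0.
  exists (maxn (var_index v).+1 k) => w /= [<-|/ks ws]; first exact: leq_maxl.
  by rewrite leq_max ws orbT.
elim: G => [|A G [k kG]]; first by exists 0 => v _ A w [].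
have [m mA] := In_bound (ef_fv A).
exists (maxn m k) => v; rewrite geq_max => /andP[mv kv] D w /= [<-|DG].
  by move=> /mA wm /stands_for_index wv; move: wm; rewrite wv ltnNge mv.
exact: (kG v kv D w DG).
Qed.

Lemma fresh_nil (L : language) (v : var L) : fresh v [::].
Proof. by move=> A w []. Qed.

(** For existential types the individual variable is prescribed by the formula and cannot be chosen
    large. Its freshness is checked as plain non-occurrence. *)
Lemma fresh_cons_VI (L : language) (x : nat) (A : ef L) (G : seq (ef L)) :
  ~ List.In (VI x) (ef_fv A) -> fresh (VI x) G -> fresh (VI x) (A :: G).
Proof.
move=> xA xG D w /= [<-|]; last exact: xG.
by case: w => [y|m C|m C|m C] yA //= eyx; apply: xA; rewrite -eyx.
Qed.

(** * Functional variables, and preservation of denotation along equations *)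

Lemma typed_hvar (L : language) (B : atomic_base L) (j x : nat) (A : fm L) :
  FORM A -> typed B true (hvar j x A (Fv x)) A.
Proof.
move=> fA; rewrite -{2}(fm_subst_id x A).
by apply: ty_h => //; apply: TERM_var.
Qed.

Lemma EFORM_fvar_typing (L : language) (B : atomic_base L) (i j : nat) (A C : fm L) :
  FORM A -> FORM C ->
  EFORM B (Pi (VT i A) (Sup (Gr (xi i A) A) (Gr (fvar j C (xi i A)) C))).
Proof.
move=> fA fC; apply: EF_Pi; first exact: ok_VT.
apply: EF_Sup; apply: EF_Gr; first exact: ty_var.
by apply: ty_f => //; apply: ty_var.
Qed.

(** Instantiating the quantified typed-variable by [xi k A] passes from the bound name [i] to the
    proper variable [k] opened by a D-rule. *)
Lemma gg_fvar_typing (L : language) (B : atomic_base L) (G : seq (ef L))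
    (i j k : nat) (A C : fm L) : FORM A -> FORM C ->
  GG B G (Pi (VT i A) (Sup (Gr (xi i A) A) (Gr (fvar j C (xi i A)) C))) ->
  GG B G (Gr (xi k A) A) -> GG B G (Gr (fvar j C (xi k A)) C).
Proof.
move=> fA fC GPi; apply: gg_supE.
have tk e : typed B e (xi k A) A by exact: ty_var.
apply: gg_PiE GPi.
  by apply: EF_Sup; apply: EF_Gr => //; apply: ty_f (tk false).
have -> : Sup (Gr (xi k A) A) (Gr (fvar j C (xi k A)) C) =
    ef_substT i A (xi k A) (Sup (Gr (xi i A) A) (Gr (fvar j C (xi i A)) C)).
  by rewrite /ef_substT /ef_mapT /= /repT /= !eqxx.
exact: inst_T.
Qed.

(** The last step of all five eliminations: [T] is the eliminatory term, [U] the same term on the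
    canonical argument, [Z] its contractum. *)
Lemma gg_pres_trans (L : language) (B : atomic_base L) (G : seq (ef L))
    (T U Z : gt L) (A : fm L) : typed B true T A ->
  GG B G (Equ T U) -> GG B G (Equ U Z) -> GG B G (Gr Z A) -> GG B G (Gr T A).
Proof.
move=> tT TU UZ; apply: gg_pres; first exact: EF_Gr.
exact: gg_trans UZ.
Qed.

Lemma gg_incl_cons2 (L : language) (B : atomic_base L) (G : seq (ef L)) (E1 E2 A : ef L) :
  GG B G A -> GG B [:: E1, E2 & G] A.
Proof. by apply: gg_weaken => D DG; right; right. Qed.

(** * The eliminatory operations as derived rules *)

Lemma gg_andE (L : language) (B : atomic_base L) (G : seq (ef L)) (A1 A2 : fm L)
    (s : side) (T : gt L) : FORM A1 -> FORM A2 -> typed B true T (fAnd A1 A2) ->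
  GG B G (Gr T (fAnd A1 A2)) -> GG B G (Gr (gAndE s T) (sel s A1 A2)).
Proof.
move=> f1 f2 tT GT; have [k kfresh] := exists_fresh_index [:: Gr (gAndE s T) (sel s A1 A2)].
have t1 : typed B true (xi k A1) A1 by exact: ty_var.
(* The indices differ because [A1] and [A2] may coincide, while [gg_Dand] wants two distinct proper
   variables. *)
have t2 : typed B true (xi k.+1 A2) A2 by exact: ty_var.
have tI := ty_andI t1 t2.
(* The minor premise uses only the discharged assumptions, so [D] is empty and freshness for the
   conclusion suffices. *)
rewrite -(cats0 G); apply: (@gg_Dand _ _ _ _ k k.+1 T A1 A2) => //.
- by case=> /eqP; rewrite (ltn_eqF (ltnSn k)).
- exact: kfresh.
- exact: kfresh.
apply: (gg_pres_trans (U := gAndE s (gAndI (xi k A1) (xi k.+1 A2)))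
          (Z := sel s (xi k A1) (xi k.+1 A2))).
- exact: ty_andE.
- apply: gg_cong_andE; first exact: EF_Equ (ty_andE s tT) (ty_andE s tI).
  by apply: gg_assume; [exact: EF_Equ tT tI | left].
- apply: gg_eq_and; apply: EF_Equ (ty_andE s tI) _.
  by case: (s).
by case: (s); apply: gg_assume; rewrite /=; auto; apply: EF_Gr.
Qed.

Lemma gg_orE (L : language) (B : atomic_base L) (G : seq (ef L)) (A1 A2 C : fm L)
    (i1 i2 j1 j2 : nat) (T : gt L) : FORM A1 -> FORM A2 -> FORM C ->
  typed B true T (fOr A1 A2) -> GG B G (Gr T (fOr A1 A2)) ->
  GG B G (Pi (VT i1 A1) (Sup (Gr (xi i1 A1) A1) (Gr (fvar j1 C (xi i1 A1)) C))) ->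
  GG B G (Pi (VT i2 A2) (Sup (Gr (xi i2 A2) A2) (Gr (fvar j2 C (xi i2 A2)) C))) ->
  GG B G (Gr (orE i1 A1 i2 A2 T (fvar j1 C (xi i1 A1)) (fvar j2 C (xi i2 A2))) C).
Proof.
move=> f1 f2 fC tT GT G1 G2; set U1 := fvar j1 C _; set U2 := fvar j2 C _.
have tf j i A : FORM A -> typed B true (fvar j C (xi i A)) C.
  by move=> fA; apply: ty_f => //; apply: ty_var.
have tE S : typed B true S (fOr A1 A2) -> typed B true (orE i1 A1 i2 A2 S U1 U2) C.
  by move=> tS; apply: ty_orE tS _ _; apply: tf.
have [k kfresh] := exists_fresh_index (Gr (orE i1 A1 i2 A2 T U1 U2) C :: G).
(* Both minor premises are handled uniformly in [s]. They are separate derivations, so the same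
   index [k] serves in each. *)
have branch s : let A := sel s A1 A2 in
    GG B [:: Equ T (gOrI s A1 A2 (xi k A)), Gr (xi k A) A & G]
      (Gr (orE i1 A1 i2 A2 T U1 U2) C).
  move=> A; have fA : FORM A by rewrite /A; case: (s).
  have tk e : typed B e (xi k A) A by exact: ty_var.
  have tI := ty_orI f1 f2 (tk true).
  pose W := fvar (sel s j1 j2) C (xi k A).
  have eW : sel s (gt_substT i1 A1 (xi k A) U1) (gt_substT i2 A2 (xi k A) U2) = W.
    by rewrite /U1 /U2 !fvar_substT /W; case: (s).
  apply: (gg_pres_trans (U := orE i1 A1 i2 A2 (gOrI s A1 A2 (xi k A)) U1 U2) (Z := W)).
  - exact: tE.
  - apply: gg_cong_orE.
    + exact: EF_Equ (tE _ tT) (tE _ tI).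
    + by apply: gg_assume; [exact: EF_Equ tT tI | left].
    + by apply: gg_refl; apply: tf.
    + by apply: gg_refl; apply: tf.
  - rewrite -eW; apply: gg_eq_or; first exact: tk.
    by rewrite eW; apply: EF_Equ (tE _ tI) _; apply: tf.
  apply: (gg_fvar_typing (i := sel s i1 i2)) => //; last first.
    by apply: gg_assume; [exact: EF_Gr | right; left].
  by apply: gg_incl_cons2; rewrite /A; case: (s).
(* Each minor premise also uses [G], for the typing of its functional variable. The rule
   concatenates the three contexts, and weakening contracts them. *)
apply: (@gg_weaken _ _ (G ++ G ++ G)).
  by move=> D /(@In_cat _ _ _ _)[|/(@In_cat _ _ _ _)[]].
apply: (@gg_Dor _ _ _ _ _ k k T A1 A2) => //.
- exact: kfresh.
- exact: kfresh.
Qed.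

Lemma gg_impE (L : language) (B : atomic_base L) (G : seq (ef L)) (A C : fm L)
    (j : nat) (T : gt L) : FORM A -> FORM C -> typed B true T (fImp A C) ->
  GG B G (Gr T (fImp A C)) -> GG B G (Gr (xi j A) A) ->
  GG B G (Gr (gImpE T (xi j A)) C).
Proof.
move=> fA fC tT GT GA.
have tA e : typed B e (xi j A) A by exact: ty_var.
have [k kfresh] := exists_fresh_index (Gr (gImpE T (xi j A)) C :: G).
(* The bound variable of the canonical term is given the index [j] of the argument, so the
   contractum is [f] itself. *)
pose f := fvar k C (xi j A).
have tf : typed B true f C by exact: ty_f (tA false).
have tI : typed B true (impI j A f) (fImp A C) by exact: ty_impI.
apply: (@gg_weaken _ _ (G ++ G)); first by move=> D /(@In_cat _ _ _ _)[].
apply: (@gg_Dimp _ _ _ _ j k T A C) => //; first exact: kfresh.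
apply: (gg_pres_trans (U := gImpE (impI j A f) (xi j A)) (Z := f)).
- exact: ty_impE tT (tA true).
- apply: gg_cong_impE; first exact: EF_Equ (ty_impE tT (tA true)) (ty_impE tI (tA true)).
    by apply: gg_assume; [exact: EF_Equ tT tI | left].
  exact: gg_refl (tA true).
- rewrite -[X in GG _ _ (Equ _ X)](fvar_substT j k A C (xi j A)).
  apply: gg_eq_imp; first exact: tA.
  by rewrite fvar_substT; apply: EF_Equ (ty_impE tI (tA true)) tf.
apply: (gg_fvar_typing (i := j)) => //; last exact: gg_incl_cons2.
by apply: gg_assume; [exact: EFORM_fvar_typing | right; left].
Qed.

Lemma gg_allE (L : language) (B : atomic_base L) (G : seq (ef L)) (A : fm L)
    (x : nat) (t : tm L) (T : gt L) : FORM A -> TERM t ->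
  typed B true T (fAll x A) -> GG B G (Gr T (fAll x A)) ->
  GG B G (Gr (allE x A t T) (fm_subst x t A)).
Proof.
move=> fA tt tT GT.
have [k kfresh] := exists_fresh_index [:: Gr (allE x A t T) (fm_subst x t A)].
have tE S : typed B true S (fAll x A) -> typed B true (allE x A t S) (fm_subst x t A).
  exact: ty_allE.
have th := typed_hvar B k x fA.
have tht : typed B true (hvar k x A t) (fm_subst x t A) by exact: ty_h.
have tI : typed B true (allI x (hvar k x A (Fv x))) (fAll x A).
  (* The side condition on types is vacuous: only a functional variable and individual variables are
     free in this body. *)
  apply: ty_allI th _ => i D /= [//|].
  by case/(@In_cat _ _ _ _)=> [/In_fvI[]|[]].
rewrite -(cats0 G); apply: (@gg_Dall _ _ _ _ k x T A) => //; first exact: kfresh.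
apply: (gg_pres_trans (U := allE x A t (allI x (hvar k x A (Fv x))))
          (Z := hvar k x A t)).
- exact: tE.
- apply: gg_cong_allE; first exact: EF_Equ (tE _ tT) (tE _ tI).
  by apply: gg_assume; [exact: EF_Equ tT tI | left].
- rewrite -[X in GG _ _ (Equ _ X)]hvar_subst; apply: gg_eq_all => //.
  by rewrite hvar_subst; apply: EF_Equ (tE _ tI) tht.
apply: (@gg_PiE _ _ _ (VI x) (Gr (hvar k x A (Fv x)) A)).
- exact: EF_Gr.
(* The second assumption discharged by [gg_Dall] is instantiated at [t]. *)
- rewrite -(hvar_subst k x A t); exact: inst_I.
apply: gg_assume; last by right; left.
by apply: EF_Pi; [exact: ok_VI | exact: EF_Gr].
Qed.

(** The proper individual variable of [gg_Dex] is taken to be the [x] bound by [exE]; hence the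
    freshness hypothesis on [x]. *)
Lemma gg_exE (L : language) (B : atomic_base L) (G : seq (ef L)) (A C : fm L)
    (x i j : nat) (T : gt L) : FORM A -> FORM C -> x \notin fm_fv C ->
  typed B true T (fEx x A) ->
  fresh (VI x) (Gr (exE x i A T (fvar j C (xi i A))) C :: G) ->
  GG B G (Gr T (fEx x A)) ->
  GG B G (Pi (VI x) (Pi (VT i A) (Sup (Gr (xi i A) A) (Gr (fvar j C (xi i A)) C)))) ->
  GG B G (Gr (exE x i A T (fvar j C (xi i A))) C).
Proof.
move=> fA fC xC tT xG GT GPi.
have [k kfresh] := exists_fresh_index (Gr (exE x i A T (fvar j C (xi i A))) C :: G).
have tk e : typed B e (xi k A) A by exact: ty_var.
have tf m : typed B true (fvar j C (xi m A)) C by apply: ty_f => //; apply: ty_var.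
have tE S : typed B true S (fEx x A) -> typed B true (exE x i A S (fvar j C (xi i A))) C.
  (* The only typed-variable free in the minor argument is [xi i A], whose type is exempt from the
     proviso. *)
  move=> tS; apply: ty_exE => // m D /= [//|].
  by case/(@In_cat _ _ _ _)=> [/In_fvI[]//|[[_ ->]//|/In_fvI[]//]].
have tx : TERM (Fv x : tm L) by exact: TERM_var.
have tI : typed B true (exI x A (Fv x) (xi k A)) (fEx x A).
  by apply: ty_exI => //; rewrite fm_subst_id.
have eW : gt_subst2 x (Fv x) i A (xi k A) (fvar j C (xi i A)) = fvar j C (xi k A).
  by rewrite /gt_subst2 /gt_absT /gt_subst /= /repT /= !eqxx /= fm_repl_id.
apply: (@gg_weaken _ _ (G ++ G)); first by move=> D /(@In_cat _ _ _ _)[].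
apply: (@gg_Dex _ _ _ _ k x T A) => //; first exact: kfresh.
apply: (gg_pres_trans (U := exE x i A (exI x A (Fv x) (xi k A)) (fvar j C (xi i A)))
          (Z := fvar j C (xi k A))).
- exact: tE.
- apply: gg_cong_exE; first exact: EF_Equ (tE _ tT) (tE _ tI).
    by apply: gg_assume; [exact: EF_Equ tT tI | left].
  exact: gg_refl (tf i).
- rewrite -[X in GG _ _ (Equ _ X)]eW; apply: gg_eq_ex => //; first by rewrite fm_subst_id.
  by rewrite eW; apply: EF_Equ (tE _ tI) (tf k).
apply: (gg_fvar_typing (i := i)) => //; last first.
  by apply: gg_assume; [exact: EF_Gr | right; left].
(* The outer quantifier over [x] is instantiated by [x] itself. *)
apply: gg_incl_cons2; apply: gg_PiE GPi; first exact: EFORM_fvar_typing.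
exact: inst_self.
Qed.

(** * Closing under implication and quantifiers *)

Lemma EFORM_xi (L : language) (B : atomic_base L) (i : nat) (A : fm L) :
  FORM A -> EFORM B (Gr (xi i A) A).
Proof. by move=> fA; apply/EF_Gr/ty_var. Qed.

Lemma gg_timesEl (L : language) (B : atomic_base L) (G : seq (ef L)) (A C : ef L) :
  GG B G (Times A C) -> GG B G A.
Proof. exact: (@gg_timesE _ _ _ Fst). Qed.

Lemma gg_timesEr (L : language) (B : atomic_base L) (G : seq (ef L)) (A C : ef L) :
  GG B G (Times A C) -> GG B G C.
Proof. exact: (@gg_timesE _ _ _ Snd). Qed.

Lemma gg_PiI_nil (L : language) (B : atomic_base L) (v : var L) (A : ef L) :
  var_ok v -> GG B [::] A -> GG B [::] (Pi v A).
Proof. by move=> okv; apply: gg_PiI => //; apply: fresh_nil. Qed.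

Lemma gg_supI_assume (L : language) (B : atomic_base L) (G : seq (ef L)) (A C : ef L) :
  EFORM B A -> (GG B (A :: G) A -> GG B (A :: G) C) -> GG B G (Sup A C).
Proof.
by move=> fA dC; apply: gg_supI => //; apply: dC; apply: gg_assume => //; left.
Qed.

Theorem mainTheorem3 (L : language) (B : atomic_base L) :
  (forall (A1 A2 : fm L) (i : nat) (s : side), FORM A1 -> FORM A2 ->
     GG B [::]
       (Pi (VT i (fAnd A1 A2))
          (Sup (Gr (xi i (fAnd A1 A2)) (fAnd A1 A2))
               (Gr (gAndE s (xi i (fAnd A1 A2))) (sel s A1 A2))))) /\
  (forall (A1 A2 C : fm L) (i i1 i2 j1 j2 : nat),
     FORM A1 -> FORM A2 -> FORM C -> j1 <> j2 ->
     GG B [::]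
       (Pi (VT i (fOr A1 A2)) (Pi (VF j1 C) (Pi (VF j2 C)
          (Sup
             (Times
                (Times (Gr (xi i (fOr A1 A2)) (fOr A1 A2))
                   (Pi (VT i1 A1) (Sup (Gr (xi i1 A1) A1)
                                       (Gr (fvar j1 C (xi i1 A1)) C))))
                (Pi (VT i2 A2) (Sup (Gr (xi i2 A2) A2)
                                    (Gr (fvar j2 C (xi i2 A2)) C))))
             (Gr (orE i1 A1 i2 A2 (xi i (fOr A1 A2))
                    (fvar j1 C (xi i1 A1)) (fvar j2 C (xi i2 A2))) C)))))) /\
  (forall (A C : fm L) (i j : nat), FORM A -> FORM C ->
     GG B [::]
       (Pi (VT i (fImp A C)) (Pi (VT j A)
          (Sup (Times (Gr (xi i (fImp A C)) (fImp A C)) (Gr (xi j A) A))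
               (Gr (gImpE (xi i (fImp A C)) (xi j A)) C))))) /\
  (forall (A : fm L) (x : nat) (t : tm L) (i : nat), FORM A -> TERM t ->
     GG B [::]
       (Pi (VT i (fAll x A))
          (Sup (Gr (xi i (fAll x A)) (fAll x A))
               (Gr (allE x A t (xi i (fAll x A))) (fm_subst x t A))))) /\
  (forall (A C : fm L) (x i i1 j : nat),
     FORM A -> FORM C -> x \notin fm_fv C ->
     GG B [::]
       (Pi (VT i (fEx x A)) (Pi (VF j C)
          (Sup
             (Times (Gr (xi i (fEx x A)) (fEx x A))
                (Pi (VI x) (Pi (VT i1 A)
                   (Sup (Gr (xi i1 A) A) (Gr (fvar j C (xi i1 A)) C)))))
             (Gr (exE x i1 A (xi i (fEx x A)) (fvar j C (xi i1 A))) C))))).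
Proof.
split; [|split; [|split; [|split]]].
- move=> A1 A2 i s f1 f2; have f12 := FORM_and f1 f2.
  apply: gg_PiI_nil; first exact: ok_VT.
  apply: gg_supI_assume; first exact: EFORM_xi.
  by apply: gg_andE => //; apply: ty_var.
- move=> A1 A2 C i i1 i2 j1 j2 f1 f2 fC _; have f12 := FORM_or f1 f2.
  apply: gg_PiI_nil; first exact: ok_VT.
  apply: gg_PiI_nil; first exact: ok_VF.
  apply: gg_PiI_nil; first exact: ok_VF.
  apply: gg_supI_assume => [|H].
    apply: EF_Times; last exact: EFORM_fvar_typing.
    by apply: EF_Times; [exact: EFORM_xi | exact: EFORM_fvar_typing].
  apply: gg_orE => //; first exact: ty_var.
  - exact: gg_timesEl (gg_timesEl H).
  - exact: gg_timesEr (gg_timesEl H).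
  - exact: gg_timesEr H.
- move=> A C i j fA fC; have fAC := FORM_imp fA fC.
  apply: gg_PiI_nil; first exact: ok_VT.
  apply: gg_PiI_nil; first exact: ok_VT.
  apply: gg_supI_assume => [|H]; first by apply: EF_Times; exact: EFORM_xi.
  apply: gg_impE => //; first exact: ty_var.
  - exact: gg_timesEl H.
  - exact: gg_timesEr H.
- move=> A x t i fA tt; have fallA := FORM_all x fA.
  apply: gg_PiI_nil; first exact: ok_VT.
  apply: gg_supI_assume; first exact: EFORM_xi.
  by apply: gg_allE => //; apply: ty_var.
move=> A C x i i1 j fA fC xC; have fexA := FORM_ex x fA.
apply: gg_PiI_nil; first exact: ok_VT.
apply: gg_PiI_nil; first exact: ok_VF.
apply: gg_supI_assume => [|H].
  apply: EF_Times; first exact: EFORM_xi.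
  by apply: EF_Pi; [exact: ok_VI | exact: EFORM_fvar_typing].
apply: gg_exE => //; last 2 first.
- exact: gg_timesEl H.
- exact: gg_timesEr H.
- exact: ty_var.
(* It remains to see that [x] is free neither in the conclusion nor in the assumption. Every copy of
   [A] there is abstracted over [x], either in the existential type or under a binder of [x], and
   the other copies are of [C], where [x] is not free. *)
have xabs D : List.In (VI x) (fm_fvI (fm_abs x D)) -> False.
  by case/In_fvI=> y [<-]; apply/negP/fm_fv_abs.
have xfvC : List.In (VI x) (fm_fvI C) -> False.
  by case/In_fvI=> y [<-]; apply/negP.
have memC u s : List.In (VI x) (u ++ s) -> List.In (VI x) u \/ List.In (VI x) s.
  exact: (@In_cat _ _ _ _).
apply: fresh_cons_VI; last apply: fresh_cons_VI; last exact: fresh_nil.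
- rewrite /exE /gt_abs /gt_absT /= /repT /= !eqxx /= fm_repl_fresh // cats0.
  case/memC=> [/memC[/xabs|[]]|/xfvC] //.
  by case/memC=> [/xabs|[|/xfvC]].
rewrite /Pi /ef_abs /ef_mapT /= /repT /= !eqxx /= (fm_repl_fresh _ _ xC) cats0.
case=> // /memC[/memC[]/xabs|/memC[/xabs|/memC[/xabs|[|/memC[]/xfvC]]]] //.
Qed.
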